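(* For all integers $n\ge 1$ and $m\ge 3$, $$\hat{r}(2K_2,nP_m)\le \min\{nm+1,\,(n+1)(m-1)\}.$$
   Context: All graphs are finite and simple. The size $e(F)$ of a graph $F$ is its number of edges. For graphs $F,G,H$, write $F\to(G,H)$ if for every coloring of the edges of $F$ with the colors red and blue, $F$ contains either a subgraph isomorphic to $G$ all of whose edges are red, or a subgraph isomorphic to $H$ all of whose edges are blue (subgraphs are not necessarily induced). The size Ramsey number $\hat{r}(G,H)$ is the smallest possible size of a graph $F$ with $F\to(G,H)$. $P_m$ denotes the path on $m$ vertices (with $m-1$ edges), $nP_m$ is the disjoint union of $n$ copies of $P_m$, and $2K_2$ is the disjoint union of two edges (a matching of size 2). *)

(* Defs.v *)
From mathcomp Require Import all_boot.
From mathcomp Require Import boolp.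

Set Implicit Arguments.
Unset Strict Implicit.
Unset Printing Implicit Defensive.

Record sgraph := SGraph {
  vertex :> finType;
  adj : rel vertex;
  adj_sym : symmetric adj;
  adj_irr : irreflexive adj }.

Definition edges (F : sgraph) : {set {set F}} :=
  [set e : {set F} | [exists x, exists y, adj x y && (e == [set x; y])]].

Definition gsize (F : sgraph) : nat := #|edges F|.

Inductive color := Red | Blue.

(* A coloring is a total function on vertex sets of which only the values on
   [edges F] matter. *)
Definition coloring (F : sgraph) := {set F} -> color.

(* [F] has a (not necessarily induced) subgraph isomorphic to [G] all of whose
   edges have color [k]: [f] is the isomorphism from [G] onto that subgraph,
   whose edges are the images of the edges of [G]. *)
Definition mono_copy (F G : sgraph) (c : coloring F) (k : color) : Prop :=
  exists2 f : G -> F, injective f &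
    forall x y : G, adj x y -> adj (f x) (f y) /\ c [set f x; f y] = k.

Definition arrows (F G H : sgraph) : Prop :=
  forall c : coloring F, mono_copy G c Red \/ mono_copy H c Blue.

Section Complete.
Variable n : nat.
Definition complete_adj : rel 'I_n := fun i j => i != j.
Lemma complete_sym : symmetric complete_adj.
Proof. by move=> i j; rewrite /complete_adj eq_sym. Qed.
Lemma complete_irr : irreflexive complete_adj.
Proof. by move=> i; rewrite /complete_adj eqxx. Qed.
Definition complete : sgraph := SGraph complete_sym complete_irr.
End Complete.

Section Path.
Variable m : nat.
Definition path_adj : rel 'I_m := fun i j => (i.+1 == j) || (j.+1 == i).
Lemma path_sym : symmetric path_adj.
Proof. by move=> i j; rewrite /path_adj orbC. Qed.
Lemma path_irr : irreflexive path_adj.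
Proof. by move=> i; rewrite /path_adj orbb gtn_eqF. Qed.
Definition path_graph : sgraph := SGraph path_sym path_irr.
End Path.

Section Copies.
Variables (n : nat) (G : sgraph).
Definition copies_adj : rel ('I_n * G)%type :=
  fun u v => (u.1 == v.1) && adj u.2 v.2.
Lemma copies_sym : symmetric copies_adj.
Proof. by move=> u v; rewrite /copies_adj eq_sym adj_sym. Qed.
Lemma copies_irr : irreflexive copies_adj.
Proof. by move=> u; rewrite /copies_adj adj_irr andbF. Qed.
Definition copies : sgraph := SGraph copies_sym copies_irr.
End Copies.

(* Ramsey's theorem, which makes the size Ramsey number well defined. *)

Lemma ramsey_sets (a b : nat) : exists N, forall (T : finType) (V : {set T})
    (r : rel T), symmetric r -> N <= #|V| ->
  (exists2 A : {set T}, A \subset V /\ #|A| = a &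
     {in A &, forall x y, x != y -> r x y}) \/
  (exists2 B : {set T}, B \subset V /\ #|B| = b &
     {in B &, forall x y, x != y -> ~~ r x y}).
Proof.
elim: a b => [|a IHa] b.
  exists 0 => T V r _ _; left; exists set0; first by rewrite sub0set cards0.
  by move=> x y; rewrite inE.
elim: b => [|b [N2 IHb]].
  exists 0 => T V r _ _; right; exists set0; first by rewrite sub0set cards0.
  by move=> x y; rewrite inE.
have [N1 {}IHa] := IHa b.+1.
exists (N1 + N2).+1 => T V r symr leV.
have /set0Pn[v vV] : V != set0 by rewrite -card_gt0 (leq_trans _ leV).
pose V1 := [set x in V :\ v | r v x]; pose V2 := [set x in V :\ v | ~~ r v x].
have cV : #|V1| + #|V2| = #|V :\ v|.
  rewrite -(cardsID [set x | r v x] (V :\ v)); congr (_ + _);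
  by apply: eq_card => x; rewrite !inE // andbC.
have V1V : V1 \subset V by apply/subsetP => x; rewrite !inE => /andP[/andP[]].
have V2V : V2 \subset V by apply/subsetP => x; rewrite !inE => /andP[/andP[]].
have : (N1 <= #|V1|) || (N2 <= #|V2|).
  apply: contraLR leV; rewrite negb_or -!ltnNge => /andP[l1 l2].
  rewrite (cardsD1 v) vV -cV ltnS add1n.
  by rewrite -addSn leq_add // ltnW.
case/orP => [/(IHa _ _ _ symr)|/(IHb _ _ _ symr)].
- case=> [[A [sA cA] mA]|[B [sB cB] mB]]; last first.
    by right; exists B => //; split=> //; apply: subset_trans V1V.
  have vA : v \notin A.
    by apply/negP => /(subsetP sA); rewrite !inE eqxx.
  left; exists (v |: A).
    by rewrite cardsU1 vA cA subUset sub1set vV (subset_trans sA).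
  have rA z : z \in A -> r v z by move/(subsetP sA); rewrite !inE => /andP[].
  move=> x y /setU1P[->|xA] /setU1P[->|yA] neq; first by rewrite eqxx in neq.
  - exact: rA.
  - by rewrite symr rA.
  - exact: mA.
- case=> [[A [sA cA] mA]|[B [sB cB] mB]].
    by left; exists A => //; split=> //; apply: subset_trans V2V.
  have vB : v \notin B.
    by apply/negP => /(subsetP sB); rewrite !inE eqxx.
  right; exists (v |: B).
    by rewrite cardsU1 vB cB subUset sub1set vV (subset_trans sB).
  have rB z : z \in B -> ~~ r v z by move/(subsetP sB); rewrite !inE => /andP[].
  move=> x y /setU1P[->|xB] /setU1P[->|yB] neq; first by rewrite eqxx in neq.
  - exact: rB.
  - by rewrite symr rB.
  - exact: mB.
Qed.

Lemma mono_copy_complete (N : nat) (G : sgraph) (c : coloring (complete N))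
    (k : color) (A : {set 'I_N}) : #|A| = #|G| ->
    {in A &, forall x y, x != y -> c [set x; y] = k} -> mono_copy G c k.
Proof.
move=> cA mA; pose f (x : G) : complete N := enum_val (cast_ord (esym cA) (enum_rank x)).
have injf : injective f by move=> x y /enum_val_inj/cast_ord_inj/enum_rank_inj.
exists f => // x y xy; have neq : f x != f y.
  by rewrite (inj_eq injf); apply: contraTneq xy => ->; rewrite adj_irr.
by split; [|apply: mA => //; apply: enum_valP].
Qed.

Lemma arrows_complete (G H : sgraph) : exists N, arrows (complete N) G H.
Proof.
have [N ramN] := ramsey_sets #|G| #|H|; exists N => c.
pose r (x y : 'I_N) := if c [set x; y] is Red then true else false.
have symr : symmetric r by move=> x y; rewrite /r setUC.
case: (ramN _ setT r symr); first by rewrite cardsT card_ord.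
- case=> A [_ cA] mA; left; apply: (mono_copy_complete cA) => x y xA yA.
  by move/(mA x y xA yA); rewrite /r; case: (c _).
- case=> B [_ cB] mB; right; apply: (mono_copy_complete cB) => x y xB yB.
  by move/(mB x y xB yB); rewrite /r; case: (c _).
Qed.

Definition arrowing_size (G H : sgraph) (k : nat) : Prop :=
  exists2 F : sgraph, gsize F = k & arrows F G H.

Lemma arrowing_size_ex (G H : sgraph) : exists k, `[< arrowing_size G H k >].
Proof.
have [N arN] := arrows_complete G H; exists (gsize (complete N)).
by apply/asboolP; exists (complete N).
Qed.

Definition size_ramsey (G H : sgraph) : nat := ex_minn (arrowing_size_ex G H).

(* Main.v *)
Require Import Defs.
From mathcomp Require Import all_boot zify.

(** Red edges without a red 2K_2 pairwise intersect.  In (n+1)P_m they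
    therefore lie in a single component, and the n others form a blue nP_m.
    In the cycle of length nm+1, which is at least 4, they share a vertex;
    deleting it leaves a blue path on nm vertices, which contains nP_m. *)

Lemma size_ramsey_le (F G H : sgraph) :
  arrows F G H -> size_ramsey G H <= gsize F.
Proof.
move=> arF; rewrite /size_ramsey; case: ex_minnP => k _; apply.
by apply/boolp.asboolP; exists F.
Qed.

(** The edge set lies in the image of [g]. Only upper bounds on sizes are needed, so [g] may repeat
    a value or take one that is not an edge. *)
Lemma gsize_le_card (F : sgraph) (I : finType) (g : I -> {set F}) :
  (forall x y : F, adj x y -> exists i, [set x; y] = g i) -> gsize F <= #|I|.
Proof.
move=> edge_g; apply: leq_trans (leq_imset_card g predT); apply/subset_leq_card.
apply/subsetP=> e; rewrite inE => /existsP[x /existsP[y /andP[xy /eqP->]]].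
by have [i ->] := edge_g x y xy; apply: imset_f.
Qed.

Lemma color_not_red (k : color) : k <> Red -> k = Blue.
Proof. by case: k. Qed.

Lemma mono_copy_2K2 (F : sgraph) (c : coloring F) (k : color) (x y z t : F) :
  adj x y -> adj z t -> uniq [:: x; y; z; t] ->
  c [set x; y] = k -> c [set z; t] = k ->
  mono_copy (copies 2 (complete 2)) c k.
Proof.
move=> xy zt uq cxy czt.
(* Copy 0 goes to [x], [y] and copy 1 to [z], [t]; the index is below 4, so the default [x] is never
   reached. *)
pose f (u : copies 2 (complete 2)) := nth x [:: x; y; z; t] (u.1 * 2 + u.2).
exists f => [[a b] [a' b']|].
  have ub (i j : 'I_2) : i * 2 + j < 4 by have := ltn_ord i; have := ltn_ord j; lia.
  move/eqP; rewrite nth_uniq ?ub //= => /eqP E.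
  have := ltn_ord b; have := ltn_ord b' => lb lb'.
  by congr pair; apply: val_inj => /=; lia.
case=> [[[|[|//]] ? [[|[|//]] ?]] [[[|[|//]] ?] [[|[|//]] ?]]] //=;
  by rewrite /copies_adj //= /f /= ?(adj_sym y) ?(adj_sym t)
    ?(setUC [set y]) ?(setUC [set t]).
Qed.

Lemma gsize_copies_path (n m : nat) :
  gsize (copies n (path_graph m.+1)) <= n * m.
Proof.
rewrite -[in leqRHS](card_ord n) -[in leqRHS](card_ord m) -card_prod.
(* An edge is indexed by its copy and its lower endpoint, which is one of the first [m] of the
   [m.+1] path vertices. *)
pose g (u : 'I_n * 'I_m) : {set copies n (path_graph m.+1)} :=
  [set (u.1, inord u.2); (u.1, inord u.2.+1)].
apply: (gsize_le_card _ _ g) => -[a b] [a' b'] /andP[/= /eqP<- {a'}].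
have edge (i j : 'I_m.+1) : i.+1 = j ->
    exists u, [set (a, i); (a, j)] = g u.
  move=> ij; have im : i < m by have := ltn_ord j; lia.
  by exists (a, Ordinal im); rewrite /g /= ij !inord_val.
case/orP=> /eqP; first exact: edge.
by rewrite setUC; apply: edge.
Qed.

Lemma arrows_copies_succ (n : nat) (G : sgraph) :
  arrows (copies n.+1 G) (copies 2 (complete 2)) (copies n G).
Proof.
move=> c.
pose red (a : 'I_n.+1) :=
  [exists x : G, exists y : G, adj x y &&
    (if c [set (a, x); (a, y)] is Red then true else false)].
have blue_off a x y : ~~ red a -> adj x y -> c [set (a, x); (a, y)] = Blue.
  move=> nred xy; apply: color_not_red => cr; case/negP: nred.
  by apply/existsP; exists x; apply/existsP; exists y; rewrite xy cr.
(* [lift a] enumerates the [n] components other than [a]. *)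
have blue_copy a : (forall b, b != a -> ~~ red b) -> mono_copy (copies n G) c Blue.
  move=> nred; exists (fun u : copies n G => (lift a u.1, u.2) : copies n.+1 G).
    move=> [i x] [j y] E; congr pair; last exact: (congr1 snd E).
    by apply: (@lift_inj _ a); exact: (congr1 fst E).
  move=> [i x] [j y] /andP[/= /eqP<- xy]; rewrite /copies_adj /= eqxx xy.
  by split=> //; apply: blue_off => //; apply: nred; rewrite eq_sym neq_lift.
have [a reda|nred] := pickP red; last by right; apply: (blue_copy ord0) => b _; rewrite nred.
have [b /andP[ba redb]|nred] := pickP [pred b | (b != a) && red b]; last first.
  by right; apply: (blue_copy a) => b ba; have /= := nred b; rewrite ba /= => ->.
left.
have /existsP[x /existsP[y /andP[xy]]] := reda.
case Ea: (c _) => // _.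
have /existsP[z /existsP[t /andP[zt]]] := redb.
case Eb: (c _) => // _.
have neq (u v : G) : adj u v -> u != v.
  by apply: contraTneq => ->; rewrite adj_irr.
apply: (mono_copy_2K2 _ _ _ _ _ _ _ _ _ _ Ea Eb); rewrite /= /copies_adj /= ?eqxx //.
by rewrite !inE !xpair_eqE !(eq_sym a) (negPf ba) !eqxx (negPf (neq _ _ xy)) (negPf (neq _ _ zt)).
Qed.

Section Cycle.
Variable N : nat.
Hypothesis N_gt1 : 1 < N.

Lemma val_iter_ordS (k : nat) (i : 'I_N) :
  iter k (@ordS N) i = (i + k) %% N :> nat.
Proof.
elim: k => [|k IHk] /=; first by rewrite addn0 modn_small.
by rewrite IHk -addn1 modnDml addn1 addnS.
Qed.

(** Equal endpoints force [j] and [k] to be congruent modulo [N]. All distinctness of cycle vertices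
    below comes from this. *)
Lemma iter_ordS_inj (i : 'I_N) (j k : nat) : j < N -> k < N ->
  iter j (@ordS N) i = iter k (@ordS N) i -> j = k.
Proof.
move=> jN kN /(congr1 val) /=; rewrite !val_iter_ordS => /eqP.
by rewrite eqn_modDl !modn_small // => /eqP.
Qed.

Definition cycle_adj : rel 'I_N := fun i j => (ordS i == j) || (ordS j == i).

Lemma cycle_adj_sym : symmetric cycle_adj.
Proof. by move=> i j; rewrite /cycle_adj orbC. Qed.

Lemma cycle_adj_irr : irreflexive cycle_adj.
Proof.
move=> i; rewrite /cycle_adj orbb; apply/eqP => E.
by have := iter_ordS_inj i 1 0 N_gt1 (ltnW N_gt1) E.
Qed.

Definition cycle_graph : sgraph := SGraph cycle_adj_sym cycle_adj_irr.

Lemma gsize_cycle : gsize cycle_graph <= N.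
Proof.
rewrite -[leqRHS]card_ord.
apply: (gsize_le_card _ _ (fun i : 'I_N => [set i; ordS i] : {set cycle_graph})).
move=> x y /orP[]/eqP <-; first by exists x.
by exists y; rewrite setUC.
Qed.

Lemma blue_path_cycle (c : coloring cycle_graph) (n m : nat) (v : 'I_N) :
  n * m < N ->
  (forall x, x != v -> ordS x != v -> c [set x; ordS x] = Blue) ->
  mono_copy (copies n (path_graph m)) c Blue.
Proof.
move=> nmN blue.
(* The vertices 1 to [n * m] steps after [v] are cut into [n] consecutive blocks of [m]; the
   successor skips [v] itself. *)
pose pos (u : 'I_n * 'I_m) := (u.1 * m + u.2).+1.
have pos_lt u : pos u < N.
  by case: u => a b; rewrite /pos /=; have := ltn_ord a; have := ltn_ord b; nia.
pose f (u : copies n (path_graph m)) : cycle_graph := iter (pos u) (@ordS N) v.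
have f_neq u : f u != v.
  by apply/eqP=> /(iter_ordS_inj v _ 0 (pos_lt u) (ltnW N_gt1)).
have step (a : 'I_n) (b b' : 'I_m) : b.+1 = b' ->
    ordS (f (a, b)) = f (a, b').
  by move=> bb'; rewrite /f /pos /= -bb' addnS.
exists f => [u u'|].
  move/(iter_ordS_inj v _ _ (pos_lt u) (pos_lt u')); case: u u' => [a b] [a' b'].
  rewrite /pos /= => -[E]; have m_gt0 : 0 < m by apply: leq_ltn_trans (ltn_ord b).
  congr pair; apply: val_inj => /=.
    (* Block and place in the block are the quotient and remainder of the position by [m]. *)
    by have := congr1 (divn^~ m) E; rewrite !divnMDl // !divn_small // !addn0.
  by have := congr1 (modn^~ m) E; rewrite !modnMDl !modn_small.
move=> [a b] [a' b'] /andP[/= /eqP<- {a'}].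
have edge (i j : 'I_m) : i.+1 = j ->
    cycle_adj (f (a, i)) (f (a, j)) /\ c [set f (a, i); f (a, j)] = Blue.
  move=> ij; rewrite -(step _ _ _ ij) /cycle_adj eqxx; split=> //.
  by apply: blue; rewrite ?(step _ _ _ ij) f_neq.
case/orP=> /eqP /edge //.
by rewrite cycle_adj_sym setUC.
Qed.

(** Write x for the edge from [x] to [ordS x], and suppose there is no red 2K_2 and i is red. If the
    next edge is red too, a red edge avoiding their common vertex [ordS i] must meet both, closing a
    triangle, which [3 < N] forbids. Otherwise every red edge contains [i]. *)
Lemma red_star_cycle (c : coloring cycle_graph) : 3 < N ->
  mono_copy (copies 2 (complete 2)) c Red \/
  exists v, forall x, x != v -> ordS x != v -> c [set x; ordS x] = Blue.
Proof.
move=> N_gt3.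
pose red (x : 'I_N) := if c [set x; ordS x] is Red then true else false.
have redP x : reflect (c [set x; ordS x] = Red) (red x).
  by rewrite /red; case: (c _); constructor.
have ordS_inj : injective (@ordS N) := can_inj (@ordSK N).
have ordSn1 (x : 'I_N) : x != ordS x.
  by apply/eqP=> /(iter_ordS_inj x 0 1 (ltnW N_gt1) N_gt1).
have matching x y : red x -> red y -> x != y -> ordS x != y -> ordS y != x ->
    mono_copy (copies 2 (complete 2)) c Red.
  move=> /redP cx /redP cy xy Sxy Syx.
  apply: (mono_copy_2K2 _ _ _ _ _ _ _ _ _ _ cx cy); rewrite /= /cycle_adj ?eqxx //.
  by rewrite !inE !negb_or !ordSn1 (inj_eq ordS_inj) (eq_sym x (ordS y)) xy Sxy Syx.
have [i redi|nred] := pickP red; last first.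
  right; exists (Ordinal (ltnW N_gt1)) => x _ _.
  by apply: color_not_red => /redP; rewrite nred.
have [M|noM] := boolp.pselect (mono_copy (copies 2 (complete 2)) c Red).
  by left.
right; have [redSi|/redP nredSi] := boolP (red (ordS i)).
  exists (ordS i) => x xSi SxSi; apply: color_not_red => /redP redx.
  have Sxi : ordS x = i.
    apply/eqP/negPn/negP=> Sxi; apply: noM; apply: (matching i x) => //.
      by apply: contraNneq SxSi => ->.
    by rewrite eq_sym.
  apply: noM; apply: (matching (ordS i) x) => //; first by rewrite eq_sym.
  (* Here [i] is one step after [x], so a shared endpoint would bring [x] back to itself in three
     steps. *)
  by rewrite -Sxi; apply/eqP=> /(iter_ordS_inj x 3 0 N_gt3 (ltnW N_gt1)).
exists i => x xi Sxi; apply: color_not_red => cx.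
apply: noM; apply: (matching i x) => //; [exact/redP|by rewrite eq_sym|].
by apply: contra_not_neq nredSi => ->.
Qed.

End Cycle.

Lemma arrows_cycle (N n m : nat) (N_gt1 : 1 < N) : 3 < N -> n * m < N ->
  arrows (cycle_graph N N_gt1) (copies 2 (complete 2)) (copies n (path_graph m)).
Proof.
move=> N_gt3 nmN c; case: (red_star_cycle _ _ c N_gt3) => [|[v blue]]; first by left.
by right; apply: blue_path_cycle blue.
Qed.

Theorem theorem3p1 (n m : nat) (hn : 1 <= n) (hm : 3 <= m) :
  size_ramsey (copies 2 (complete 2)) (copies n (path_graph m))
    <= minn (n * m + 1) ((n + 1) * (m - 1)).
Proof.
rewrite leq_min !addn1; apply/andP; split.
  have N_gt1 : 1 < (n * m).+1 by nia.
  apply: leq_trans (gsize_cycle _ N_gt1); apply/size_ramsey_le/arrows_cycle => //.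
  (* Since [n * m] is at least 3, the cycle is longer than a triangle, which colored all red would
     have neither a red 2K_2 nor a blue edge. *)
  by nia.
(* From here [m] counts the edges of each path instead of its vertices. *)
case: m hm => // m _; rewrite subn1; apply: leq_trans (gsize_copies_path _ _).
exact/size_ramsey_le/arrows_copies_succ.
Qed.
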